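(* Let $a,b,c,d$ be fixed complex numbers with $c\neq 0$. Let $x=(x_n)_{n\in\mathbb{N}}$ be a sequence and let $y=\mathscr{Y}_{a,b,c,d}(x)$, that is, \[ y_n=\sum_{k=1}^n \frac{1}{n!}\bigg[\prod_{j=1}^{k-1}(an+bk+cj+d)\bigg]B_{n,k}(1!x_1,2!x_2,\dots)\quad\text{for } n\ge 1. \] Then for every $n\in\mathbb{N}$ and every $\lambda\in\mathbb{C}$, \[ \sum_{k=1}^n \bigg[\prod_{j=1}^{k-1}(\lambda-dj+d)\bigg]B_{n,k}(1!y_1,2!y_2,\dots) =\sum_{k=1}^n \bigg[\prod_{j=1}^{k-1}(an+bk+cj+d+\lambda)\bigg] B_{n,k}(1!x_1,2!x_2,\dots). \]
   Context: For $k\ge 0$, the (exponential) partial Bell polynomials $B_{n,k}(z_1,z_2,\dots)$ are defined by $\frac{1}{k!}\big(\sum_{j\ge1} z_j \frac{t^j}{j!}\big)^k=\sum_{n\ge k}B_{n,k}(z_1,z_2,\dots)\frac{t^n}{n!}$; equivalently $B_{n,k}=\sum \frac{n!}{\alpha_1!\alpha_2!\cdots}\prod_i (z_i/i!)^{\alpha_i}$, summed over $\alpha\in\mathbb{N}_0^{n-k+1}$ with $\sum\alpha_i=k$ and $\sum i\alpha_i=n$. An empty product equals $1$. For parameters $a,b,c,d$, the Bell transform $\mathscr{Y}_{a,b,c,d}$ maps a sequence $x$ to the sequence $y$ given by the displayed formula. *)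

(* Defs.v *)
From mathcomp Require Import all_boot all_order all_algebra.

Set Implicit Arguments.
Unset Strict Implicit.
Unset Printing Implicit Defensive.

Import GRing.Theory.
Local Open Scope ring_scope.

(* A formal power series over K is represented by its coefficient sequence. *)
Definition fps_one (K : fieldType) : nat -> K := fun n => (n == 0%N)%:R.

Definition fps_mul (K : fieldType) (f g : nat -> K) : nat -> K :=
  fun n => \sum_(i < n.+1) f i * g (n - i)%N.

Definition fps_exp (K : fieldType) (f : nat -> K) (k : nat) : nat -> K :=
  iter k (fps_mul f) (fps_one K).

(* \sum_(j >= 1) z_j t^j / j!; the value z 0 is never used. *)
Definition egf (K : fieldType) (z : nat -> K) : nat -> K :=
  fun j => if j == 0%N then 0 else z j / (j`!)%:R.

(* n! times the coefficient of t^n in (1/k!) (\sum_(j >= 1) z_j t^j / j!)^k;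
   this coefficient vanishes when n < k. *)
Definition bell (K : fieldType) (n k : nat) (z : nat -> K) : K :=
  (n`!)%:R * ((k`!)%:R^-1 * fps_exp (egf z) k n).

(* Sequences indexed by the positive integers are functions on nat whose value
   at 0 is irrelevant. *)
Definition bell_transform (K : fieldType) (a b c d : K) (x : nat -> K) :
    nat -> K := fun n =>
  \sum_(1 <= k < n.+1)
     (n`!)%:R^-1 *
     (\prod_(1 <= j < k) (a * n%:R + b * k%:R + c * j%:R + d)) *
     bell n k (fun i => (i`!)%:R * x i).

(* Main.v *)
Require Import Defs.
From mathcomp Require Import all_boot all_order all_algebra.
From mathcomp Require Import boolp reals complex.
From mathcomp Require Import ring.

(** Call polynomials [q_n] of convolution type if [Q(u) = sum_n q_n(u) t^n]
    satisfies [Q(u + v) = Q(u) Q(v)], with [q_0 = 1] and [u | q_n(u)] for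
    [n >= 1].  This property is stable under substituting a power series for [t]
    and, by Lagrange inversion, under [q_n(u) |-> u / (u + a n) q_n(u + a n)].
    Starting from [u (u + c) ... (u + (n - 1) c) / n!], twisting by [b],
    substituting [sum_j x_j t^j] and twisting by [a] gives the right-hand side of
    the theorem, multiplied by [u = lambda + d] and divided by [n!].  The
    left-hand side comes likewise from [u (u - d) ... (u - (n - 1) d) / n!] and
    [sum_j y_j t^j].  A family of convolution type is determined by the values
    [q_n(u) / u] at a single point, since by induction the difference of two
    [n]-th terms is additive, hence linear, in [u]; at [u = d] both sides give
    [y_n]. *)

Set Implicit Arguments.
Unset Strict Implicit.
Unset Printing Implicit Defensive.

Import GRing.Theory Num.Theory.
Local Open Scope ring_scope.
Local Open Scope complex_scope.

                            

(** * Formal power series: product, Euler operator, shift and substitution *)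

Section PowerSeries.
Variable K : fieldType.
Implicit Types (f g h : nat -> K).

(** Truncation transports the ring laws from polynomials: the coefficient of t^n in a product sees
    only terms of index at most n. *)
Definition fps_trunc (N : nat) f : {poly K} := \poly_(i < N) f i.

Lemma fps_mul_coef (N : nat) f g (n : nat) : (n < N)%N ->
  fps_mul f g n = (fps_trunc N f * fps_trunc N g)`_n.
Proof.
move=> nN; rewrite coefM; apply: eq_bigr => i _; rewrite !coef_poly.
have iN : (i < N)%N by apply: leq_trans nN; apply: ltn_ord.
by rewrite iN (leq_ltn_trans (leq_subr i n) nN).
Qed.

Lemma fps_mulC : commutative (@fps_mul K).
Proof.
by move=> f g; apply/funext => n; rewrite !(@fps_mul_coef n.+1) // mulrC.
Qed.

Lemma fps_mulA : associative (@fps_mul K).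
Proof.
move=> f g h; apply/funext => n.
transitivity ((fps_trunc n.+1 f * (fps_trunc n.+1 g * fps_trunc n.+1 h))`_n).
  rewrite coefM; apply: eq_bigr => i _.
  by rewrite coef_poly ltn_ord -fps_mul_coef // ltnS leq_subr.
rewrite mulrA coefM; apply: eq_bigr => i _.
by rewrite coef_poly ltnS leq_subr -fps_mul_coef.
Qed.

Lemma fps_mul1 : left_id (fps_one K) (@fps_mul K).
Proof.
move=> f; apply/funext => n; rewrite /fps_mul big_ord_recl /fps_one /= mul1r subn0.
by rewrite big1 ?addr0 // => i _; rewrite mul0r.
Qed.

Lemma fps_mulr1 : right_id (fps_one K) (@fps_mul K).
Proof. by move=> f; rewrite fps_mulC fps_mul1. Qed.

Lemma fps_mulACA : interchange (@fps_mul K) (@fps_mul K).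
Proof.
by move=> f g h k; rewrite -!fps_mulA; congr fps_mul; rewrite fps_mulA (fps_mulC g) fps_mulA.
Qed.

(** The Euler operator t d/dt. *)
Definition fps_theta f : nat -> K := fun n => n%:R * f n.

Lemma fps_theta_mul f g (n : nat) :
  fps_theta (fps_mul f g) n = fps_mul (fps_theta f) g n + fps_mul f (fps_theta g) n.
Proof.
rewrite /fps_theta /fps_mul mulr_sumr -big_split; apply: eq_bigr => i _ /=.
have iN : (i <= n)%N by rewrite -ltnS.
by rewrite -{1}(subnKC iN) natrD; ring.
Qed.

Lemma fps_mulDl f g h (n : nat) :
  fps_mul (fun m => f m + g m) h n = fps_mul f h n + fps_mul g h n.
Proof. by rewrite /fps_mul -big_split; apply: eq_bigr => i _; rewrite mulrDl. Qed.

(** Multiplication by t^i. *)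
Definition fps_shift (i : nat) f : nat -> K :=
  fun n => if (i <= n)%N then f (n - i)%N else 0.

Lemma fps_mul_shift (i : nat) f g :
  fps_mul (fps_shift i f) g = fps_shift i (fps_mul f g).
Proof.
apply/funext => n; rewrite /fps_shift /fps_mul -(big_mkord xpredT
  (fun k => (if (i <= k)%N then f (k - i)%N else 0) * g (n - k)%N)).
case: leqP => ni.
  rewrite (big_cat_nat (n := i)) //=; last by apply: leq_trans ni _.
  rewrite big_nat big1 ?add0r; last by move=> k /andP[_ ki]; rewrite leqNgt ki mul0r.
  rewrite -{1}(add0n i) big_addn subSn // big_mkord; apply: eq_bigr => k _.
  by rewrite leq_addl addnK addnC subnDA.
rewrite big_nat big1 // => k /andP[_ kn]; rewrite leqNgt.
by rewrite (leq_trans kn ni) mul0r.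
Qed.

Lemma fps_exp0 f : fps_exp f 0 = fps_one K.
Proof. by []. Qed.

Lemma fps_exp1 f : fps_exp f 1 = f.
Proof. exact: fps_mulr1. Qed.

Lemma fps_expD f (j k : nat) :
  fps_exp f (j + k) = fps_mul (fps_exp f j) (fps_exp f k).
Proof.
elim: j => [|j IH]; first by rewrite fps_exp0 fps_mul1.
by rewrite addSn /fps_exp /= -!/(fps_exp f _) IH fps_mulA.
Qed.

Lemma fps_exp_small f (k n : nat) : f 0%N = 0 -> (n < k)%N -> fps_exp f k n = 0.
Proof.
move=> f0; elim: k n => // k IH n nk; rewrite /fps_exp /= -/(fps_exp f _) /fps_mul.
rewrite big1 // => -[[|i] /= ik] _; first by rewrite f0 mul0r.
by rewrite IH ?mulr0 // (leq_trans _ (nk : n <= k)%N) // ltn_subrL (leq_trans _ (ik : i < n)%N).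
Qed.

(** Substitution of [h] for t. Stopping at k = n loses nothing when [h] has no constant term, since
    h^k then has no term below t^k. *)
Definition fps_comp f h : nat -> K :=
  fun n => \sum_(k < n.+1) f k * fps_exp h k n.

Lemma fps_comp_widen f h (n N : nat) : h 0%N = 0 -> (n < N)%N ->
  fps_comp f h n = \sum_(k < N) f k * fps_exp h k n.
Proof.
move=> h0 nN; rewrite /fps_comp (big_ord_widen _ (fun k => f k * fps_exp h k n) nN).
rewrite big_mkcond /=; apply: eq_bigr => k _; case: ltnP => // kn.
by rewrite fps_exp_small ?mulr0.
Qed.

(** Both sides are the sum of f_i g_j h^(i + j); the pairs with i + j > n, which only the right-hand
    side produces, contribute 0. *)
Lemma fps_comp_mul f g h : h 0%N = 0 ->
  fps_comp (fps_mul f g) h = fps_mul (fps_comp f h) (fps_comp g h).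
Proof.
move=> h0; apply/funext => n.
have -> : fps_mul (fps_comp f h) (fps_comp g h) n =
    \sum_(i < n.+1) \sum_(j < n.+1) f i * g j * fps_exp h (i + j) n.
  transitivity (\sum_(m < n.+1) \sum_(i < n.+1) \sum_(j < n.+1)
      f i * g j * (fps_exp h i m * fps_exp h j (n - m)%N)).
    apply: eq_bigr => m _; rewrite !(@fps_comp_widen _ _ _ n.+1) //; last first.
      by rewrite ltnS leq_subr.
    rewrite mulr_suml; apply: eq_bigr => i _; rewrite mulr_sumr.
    by apply: eq_bigr => j _; ring.
  rewrite exchange_big; apply: eq_bigr => i _; rewrite exchange_big.
  by apply: eq_bigr => j _; rewrite -mulr_sumr fps_expD.
rewrite /fps_comp.
transitivity (\sum_(k < n.+1) \sum_(i < n.+1 | (i <= k)%N)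
    f i * g (k - i)%N * fps_exp h k n).
  apply: eq_bigr => k _; rewrite /fps_mul mulr_suml.
  exact: (big_ord_widen _ (fun i => f i * g (k - i)%N * fps_exp h k n) (ltn_ord k)).
rewrite (exchange_big_dep xpredT) //=; apply: eq_bigr => i _.
rewrite -(big_mkord (fun k => i <= k)%N (fun k => f i * g (k - i)%N * fps_exp h k n)).
rewrite -(big_mkord xpredT (fun j => f i * g j * fps_exp h (i + j) n)).
have iN : (i <= n.+1)%N by rewrite ltnW.
rewrite (big_cat_nat (n := i)) //= [X in X + _]big_nat_cond big1 ?add0r; last first.
  by move=> k /andP[/andP[_ ki]]; rewrite leqNgt ki.
rewrite [RHS](big_cat_nat (n := n.+1 - i)) ?leq_subr //=.
rewrite [X in _ = _ + X]big_nat [X in _ = _ + X]big1 ?addr0; last first.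
  by move=> k /andP[ki _]; rewrite fps_exp_small ?mulr0 // -leq_subLR.
rewrite -{1}(add0n i) big_addn; apply: eq_big => [j|j _]; first by rewrite leq_addl.
by rewrite addnK addnC.
Qed.

End PowerSeries.

                                                

(** * Polynomial families of convolution type *)

Section ConvolutionFamilies.
Variable K : numFieldType.
Implicit Types (g : nat -> {poly K}) (p : {poly K}).

(** In characteristic 0 the numbers 0, ..., [size p] - 1 are distinct, which is more roots than a
    nonzero [p] can have. *)
Lemma poly_nat_roots_eq0 p : (forall m : nat, p.[m%:R] = 0) -> p = 0.
Proof.
move=> p0; apply/eqP; apply: contraT => pn0.
have := @max_poly_roots K p [seq m%:R | m <- iota 0 (size p)] pn0.
rewrite size_map size_iota ltnn; apply.
  by apply/allP => _ /mapP[m _ ->]; rewrite /root p0.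
by rewrite map_inj_uniq ?iota_uniq //; apply: mulrIn; rewrite oner_eq0.
Qed.

Lemma poly_eval_inj p q : (forall u : K, p.[u] = q.[u]) -> p = q.
Proof.
move=> pq; apply/eqP; rewrite -subr_eq0; apply/eqP/poly_nat_roots_eq0 => m.
by rewrite !hornerE pq subrr.
Qed.

Lemma additive_polyE p :
  (forall u v : K, p.[u + v] = p.[u] + p.[v]) -> p = p.[1] *: 'X.
Proof.
move=> pD; apply/eqP; rewrite -subr_eq0; apply/eqP/poly_nat_roots_eq0 => m.
rewrite !hornerE; apply/eqP; rewrite subr_eq0; apply/eqP.
elim: m => [|m IH]; first by apply: (addrI p.[0]); rewrite -pD mulr0 !addr0.
by rewrite -natr1 pD IH mulrDr mulr1.
Qed.

                                                                             
                                    
(** [g n] stands for q_n(u) / u, so that divisibility by u is built in and the quotient makes sense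
    at u = 0 too. *)
Definition conv_series g (u : K) : nat -> K :=
  fun n => if n == 0%N then 1 else u * (g n).[u].

Definition conv_type g : Prop :=
  forall u v : K, conv_series g (u + v) = fps_mul (conv_series g u) (conv_series g v).

Definition conv_poly g (n : nat) : {poly K} := if n == 0%N then 1 else 'X * g n.

Lemma conv_polyE g n u : (conv_poly g n).[u] = conv_series g u n.
Proof. by rewrite /conv_poly /conv_series; case: eqP => _; rewrite !hornerE. Qed.

Lemma conv_series0 g : conv_series g 0 = fps_one K.
Proof.
by apply/funext => n; rewrite /conv_series /fps_one; case: eqP => // _; rewrite mul0r.
Qed.

Lemma conv_seriesN g u : conv_type g ->
  fps_mul (conv_series g u) (conv_series g (- u)) = fps_one K.
Proof. by move=> cg; rewrite -cg subrr conv_series0. Qed.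

                                                                                      
(** Q(u) behaves like exp(u F(t)): its logarithmic derivative t Q'/Q is additive in u with
    polynomial coefficients, hence equals u w. A factor u is then cancelled from n q_n(u) = u (w
    Q(u))_n. *)
Lemma conv_type_log_derivative g : conv_type g ->
  exists w : nat -> K, forall u n,
    n%:R * (g n).[u] = fps_mul w (conv_series g u) n.
Proof.
move=> cg; pose Q := conv_series g.
pose W u := fps_mul (fps_theta (Q u)) (Q (- u)).
(* The coefficients of [W u] as polynomials in u, as [additive_polyE] requires. *)
pose Wp n := \sum_(i < n.+1)
  i%:R *: conv_poly g i * (conv_poly g (n - i) \Po (- 'X)).
have WpE n u : (Wp n).[u] = W u n.
  rewrite /Wp horner_sum; apply: eq_bigr => i _.
  by rewrite hornerM hornerZ horner_comp !conv_polyE hornerN hornerX.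
have WD u v n : W (u + v) n = W u n + W v n.
  rewrite /W opprD.
  have -> : fps_theta (Q (u + v)) = fun m =>
      fps_mul (fps_theta (Q u)) (Q v) m + fps_mul (Q u) (fps_theta (Q v)) m.
    by apply/funext => m; rewrite -fps_theta_mul /Q cg.
  have -> : Q (- u - v) = fps_mul (Q (- u)) (Q (- v)) by apply: cg.
  rewrite fps_mulDl (fps_mulACA (fps_theta (Q u))) (fps_mulACA (Q u)).
  by rewrite (conv_seriesN v cg) (conv_seriesN u cg) fps_mulr1 fps_mul1.
pose w n := (Wp n).[1].
have Wlin u n : W u n = u * w n.
  rewrite -WpE (@additive_polyE (Wp n)); first by rewrite hornerZ hornerX mulrC.
  by move=> s t; rewrite !WpE.
have thetaE u n : fps_theta (Q u) n = u * fps_mul w (Q u) n.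
  have -> : fps_theta (Q u) = fps_mul (W u) (Q u).
    by rewrite /W -fps_mulA (fps_mulC (Q (- u))) (conv_seriesN u cg) fps_mulr1.
  by rewrite /fps_mul mulr_sumr; apply: eq_bigr => i _; rewrite Wlin mulrA.
exists w => u n.
pose P := \sum_(i < n.+1) w i *: conv_poly g (n - i).
have PE s : P.[s] = fps_mul w (Q s) n.
  by rewrite /P horner_sum; apply: eq_bigr => i _; rewrite hornerZ conv_polyE.
suff -> : fps_mul w (conv_series g u) n = (n%:R *: g n).[u] by rewrite hornerZ.
(* Cancelling 'X between polynomials, rather than u between values, covers u = 0. *)
rewrite -PE; congr horner; apply: (@mulfI _ 'X); first by rewrite polyX_eq0.
apply: poly_eval_inj => s; rewrite !hornerM hornerX hornerZ PE -thetaE.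
rewrite /fps_theta /Q /conv_series; case: eqP => [->|_]; last by ring.
by rewrite !mul0r mulr0.
Qed.

(** Since [g n] is q_n(u) / u, this is the family u / (u + a n) q_n(u + a n), with no division
    left. *)
Definition twist (a : K) g : nat -> {poly K} :=
  fun n => g n \Po ('X + (a * n%:R)%:P).

(** Lagrange inversion: the twisted coefficients are those of Q(u) expanded in powers of t Q(-a), so
    Q(u + v) = Q(u) Q(v) carries over to them. *)
Lemma conv_type_twist (a : K) g : conv_type g -> conv_type (twist a g).
Proof.
move=> cg; have [w wE] := conv_type_log_derivative cg.
pose Q := conv_series g.
(* For n >= 1 the coefficient of t^n in Q(s) D is (s - a n) g_n(s); s = u + a n gives the twisted
   coefficient. *)
pose D n := fps_one K n - a * w n.
have DQ u n : fps_mul (Q (u + a * n%:R)) D n = conv_series (twist a g) u n.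
  have -> : fps_mul (Q (u + a * n%:R)) D n =
      Q (u + a * n%:R) n - a * (n%:R * (g n).[u + a * n%:R]).
    rewrite wE -{2}(fps_mul1 (Q (u + a * n%:R))) fps_mulC /fps_mul mulr_sumr -sumrB.
    by apply: eq_bigr => i _; rewrite /D /Q; ring.
  rewrite /Q /conv_series /twist; case: eqP => [->|_]; first by rewrite mul0r mulr0 subr0.
  by rewrite horner_comp hornerD hornerX hornerC; ring.
                                                                              
                                
(* [S i] is the i-th power of t Q(-a), and [L _ m] reads off the m-th coefficient of an expansion in
   these powers. *)
pose S i := fps_shift i (Q (- (a * i%:R))).
pose L f m := fps_mul f (fps_mul (Q (a * m%:R)) D) m.
have LS i v m : L (fps_mul (S i) (Q v)) m =
    fps_shift i (conv_series (twist a g) v) m.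
  rewrite /L /S !fps_mul_shift !fps_mulA -!cg /fps_shift; case: leqP => // im.
  rewrite -DQ natrB //; congr (fps_mul (Q _) D _); ring.
have LQ u m : L (Q u) m = conv_series (twist a g) u m.
  by rewrite /L fps_mulA -cg DQ.
(* Truncated at n, [L] and [S] give inverse square matrices: [LS1] is one order of the product,
   [mulmx1C] the other, whose last row applied to Q(u) is the expansion. *)
have expand u n : Q u n = \sum_(i < n.+1) conv_series (twist a g) u i * S i n.
  pose ML : 'M[K]_n.+1 := \matrix_(m, j)
    (if (j <= m)%N then fps_mul (Q (a * m%:R)) D (m - j)%N else 0).
  pose MS : 'M[K]_n.+1 := \matrix_(j, i) S i j.
  have MLE f (m : 'I_n.+1) : \sum_j ML m j * f (val j) = L f m.
    rewrite /L /fps_mul (big_ord_widen _ (fun j => f j *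
      fps_mul (Q (a * m%:R)) D (m - j)%N) (ltn_ord m)) [RHS]big_mkcond.
    by apply: eq_bigr => j _; rewrite mxE ltnS; case: ifP; rewrite ?mul0r // mulrC.
  have LS1 : ML *m MS = 1%:M.
    apply/matrixP => m i; rewrite !mxE.
    under eq_bigr do rewrite [MS _ _]mxE.
    rewrite (MLE (S i)) -(fps_mulr1 (S i)) -(conv_series0 g) LS conv_series0.
    rewrite /fps_shift /fps_one -(inj_eq val_inj) /= [in RHS]eqn_leq.
    by case: leqP => im; rewrite ?andbF // subn_eq0 andbT.
  have := mulmx1C LS1 => /(congr1 (fun A => A *m (\col_j Q u (val j)))).
  rewrite mul1mx -mulmxA => /matrixP/(_ ord_max ord0).
  rewrite !mxE /= => <-; apply: eq_bigr => i _; rewrite !mxE mulrC; congr (_ * _).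
  under eq_bigr do rewrite [(\col_ _ _) _ _]mxE.
  by rewrite (MLE (Q u)) LQ.
move=> u v; apply/funext => n; rewrite -LQ /Q cg.
(* Only Q(u) is expanded; by [LS], each S_i Q(v) then yields the twisted coefficient of v at n -
   i. *)
transitivity (\sum_(i < n.+1) conv_series (twist a g) u i * L (fps_mul (S i) (Q v)) n).
  rewrite /L -fps_mulA.
  under [RHS]eq_bigr do rewrite -fps_mulA.
  rewrite {1}/fps_mul; set T := fps_mul (Q v) _.
  transitivity (\sum_(k < n.+1) \sum_(i < n.+1)
      conv_series (twist a g) u i * (S i k * T (n - k)%N)).
    apply: eq_bigr => k _; rewrite -/(Q u k) expand mulr_suml.
    rewrite (big_ord_widen _ (fun i => conv_series (twist a g) u i * S i k *
      T (n - k)%N) (ltn_ord k)) big_mkcond; apply: eq_bigr => i _.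
    rewrite ltnS; case: leqP => ik; first by rewrite mulrA.
    by rewrite {1}/S /fps_shift leqNgt ik mul0r mulr0.
  by rewrite exchange_big; apply: eq_bigr => i _; rewrite -mulr_sumr.
by apply: eq_bigr => i _; rewrite LS /fps_shift -ltnS ltn_ord.
Qed.

(** Substitution of [h] for t, divided by u; the index k = 0 would only feed the constant term. *)
Definition family_comp g (h : nat -> K) : nat -> {poly K} :=
  fun n => \sum_(1 <= k < n.+1) fps_exp h k n *: g k.

Lemma conv_type_comp g (h : nat -> K) : h 0%N = 0 ->
  conv_type g -> conv_type (family_comp g h).
Proof.
move=> h0 cg.
have E u : conv_series (family_comp g h) u = fps_comp (conv_series g u) h.
  apply/funext => n; rewrite /conv_series /fps_comp big_ord_recl mul1r.
  rewrite fps_exp0 /fps_one; case: eqP => [->|_]; first by rewrite big_ord0 addr0.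
  rewrite add0r /family_comp horner_sum big_add1 /= big_mkord mulr_sumr.
  by apply: eq_bigr => k _; rewrite hornerZ; ring.
by move=> u v; rewrite !E cg fps_comp_mul.
Qed.

                                                                        
(** For k >= 1, u times this is the coefficient of t^k in (1 - c t)^(-u/c), or in e^(u t) when c =
    0. *)
Definition rising (c : K) (k : nat) : {poly K} :=
  (k`!)%:R^-1 *: \prod_(1 <= j < k) ('X + (c * j%:R)%:P).

(** Coefficient form of (1 - c t) Q' = u Q. *)
Lemma rising_rec (c u : K) (k : nat) :
  k.+1%:R * conv_series (rising c) u k.+1 =
  (u + c * k%:R) * conv_series (rising c) u k.
Proof.
rewrite /conv_series /rising /=; case: k => [|k] /=.
  by rewrite big_geq // hornerZ hornerC invr1; ring.
rewrite !hornerZ big_nat_recr //= factS natrM hornerM hornerD hornerX hornerC.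
by field; rewrite -natrD !pnatr_eq0 -lt0n fact_gt0.
Qed.

(** By the Leibniz rule Q(u) Q(v) obeys the recurrence of Q(u + v): in the i-th term, (u + c i) + (v
    + c (n - i)) = u + v + c n. *)
Lemma conv_type_rising (c : K) : conv_type (rising c).
Proof.
move=> u v; apply/funext; elim=> [|n IH].
  by rewrite /fps_mul big_ord1 /conv_series /= mulr1.
apply: (@mulfI _ n.+1%:R); first by rewrite pnatr_eq0.
rewrite rising_rec IH -/(fps_theta _ _) fps_theta_mul /fps_mul.
rewrite [X in _ = X + _]big_ord_recl [X in _ = _ + X]big_ord_recr /fps_theta /=.
rewrite subnn !mul0r mulr0 add0r addr0.
rewrite -big_split mulr_sumr; apply: eq_bigr => i _ /=.
have iN : (i <= n)%N by rewrite -ltnS.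
by rewrite subSS subSn // !rising_rec natrB //; ring.
Qed.

Lemma conv_type_eq (d : K) g g' : conv_type g -> conv_type g' ->
  (forall n, (0 < n)%N -> (g n).[d] = (g' n).[d]) ->
  forall n, (0 < n)%N -> g n = g' n.
Proof.
move=> cg cg' gd; elim/ltn_ind => -[//|n] IH _.
have same u i : (i < n.+1)%N -> conv_series g u i = conv_series g' u i.
  by case: i => // i iN; rewrite /conv_series /= IH.
pose p := 'X * (g n.+1 - g' n.+1).
have pE u : p.[u] = conv_series g u n.+1 - conv_series g' u n.+1.
  by rewrite /p /conv_series !hornerE /=; ring.
(* Only the two end terms involve the index n + 1; by [same] the middle sum is common to both
   families and cancels in the difference. *)
have split f h : fps_mul f h n.+1 =
    f 0%N * h n.+1 + f n.+1 * h 0%N + \sum_(i < n) f i.+1 * h (n - i)%N :> K.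
  rewrite /fps_mul big_ord_recl big_ord_recr /= subn0 subSS subnn -addrA.
  by congr (_ + _); rewrite addrC; congr (_ + _); apply: eq_bigr => i _.
have pD u v : p.[u + v] = p.[u] + p.[v].
  rewrite !pE cg cg' !split.
  under eq_bigr => i _ do rewrite !same ?ltnS ?leq_subr //.
  by rewrite /conv_series /=; ring.
(* Cancelling 'X from a linear [p] leaves a constant polynomial, which vanishes because it does at
   d. *)
have := additive_polyE pD; rewrite {1}/p mulrC -mul_polyC => /mulIf.
rewrite polyX_eq0 => /(_ isT) gg'.
have : (g n.+1 - g' n.+1).[d] = 0 by rewrite !hornerE gd // subrr.
by rewrite gg' hornerC => p1; apply/eqP; rewrite -subr_eq0 gg' p1.
Qed.

End ConvolutionFamilies.

(** * Bell polynomials as powers of ordinary series, and comparison of the two families *)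

Lemma bellE (K : numFieldType) (x : nat -> K) n k :
  bell n k (fun i => (i`!)%:R * x i) =
  (n`!)%:R * ((k`!)%:R^-1 * fps_exp (fun j => if j == 0%N then 0 else x j) k n).
Proof.
rewrite /bell; congr (_ * (_ * fps_exp _ _ _)); apply/funext => j.
by rewrite /egf; case: eqP => // _; rewrite mulrC mulKf // pnatr_eq0 -lt0n fact_gt0.
Qed.

Theorem theorem2p1 (R : realType) (a b c d : R[i]) (hc : c != 0)
    (x y : nat -> R[i])
    (hy : forall n : nat, (1 <= n)%N -> y n = bell_transform a b c d x n)
    (n : nat) (hn : (1 <= n)%N) (lambda : R[i]) :
  \sum_(1 <= k < n.+1)
     (\prod_(1 <= j < k) (lambda - d * j%:R + d)) *
     bell n k (fun i => (i`!)%:R * y i)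
  = \sum_(1 <= k < n.+1)
     (\prod_(1 <= j < k) (a * n%:R + b * k%:R + c * j%:R + d + lambda)) *
     bell n k (fun i => (i`!)%:R * x i).
Proof.
pose X j := if j == 0%N then 0 else x j.
pose Y j := if j == 0%N then 0 else y j.
pose gX := twist a (family_comp (twist b (rising c)) X).
pose gY := family_comp (rising (- d)) Y.
have gXE m u : (gX m).[u] = \sum_(1 <= k < m.+1)
    (k`!)%:R^-1 * fps_exp X k m *
    \prod_(1 <= j < k) (a * m%:R + b * k%:R + c * j%:R + u).
  rewrite /gX /twist /family_comp horner_comp horner_sum; apply: eq_bigr => k _.
  rewrite !(hornerZ, horner_comp) horner_prod mulrCA mulrA; congr (_ * _).
  by apply: eq_bigr => j _; rewrite !hornerE; ring.
have gYE m u : (gY m).[u] = \sum_(1 <= k < m.+1)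
    (k`!)%:R^-1 * fps_exp Y k m * \prod_(1 <= j < k) (u - d * j%:R).
  rewrite /gY /family_comp horner_sum; apply: eq_bigr => k _.
  rewrite !hornerZ horner_prod mulrCA mulrA; congr (_ * _).
  by apply: eq_bigr => j _; rewrite !hornerE; ring.
have gXY m : (0 < m)%N -> gX m = gY m.
  apply: (@conv_type_eq _ d).
  - exact/conv_type_twist/conv_type_comp/conv_type_twist/conv_type_rising.
  - exact/conv_type_comp/conv_type_rising.
  (* At u = d, [gX] is the defining formula of [y]. *)
  case=> // {}m _; transitivity (y m.+1).
    rewrite gXE hy //; apply: eq_bigr => k _; rewrite bellE -/X.
    by rewrite [RHS]mulrAC mulKf // pnatr_eq0 -lt0n fact_gt0.
  (* For [gY] at u = d the factor j = 1 is d - d = 0, so only k = 1 survives, with an empty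
     product. *)
  rewrite gYE big_nat_recl // big_geq // fps_exp1 invr1 mulr1 mul1r.
  rewrite big_nat big1 ?addr0 // => k /andP[k0 _].
  by rewrite big_ltn // mulr1 subrr mul0r mulr0.
(* The point u = lambda + d turns u - d j into lambda - d j + d. *)
transitivity ((n`!)%:R * (gY n).[lambda + d]).
  rewrite gYE mulr_sumr; apply: eq_bigr => k _; rewrite bellE -/Y.
  rewrite [LHS]mulrC -!mulrA; do 3!congr (_ * _).
  by apply: eq_bigr => j _; ring.
rewrite -gXY // gXE mulr_sumr; apply: eq_bigr => k _; rewrite bellE -/X.
rewrite [RHS]mulrC -!mulrA; do 3!congr (_ * _).
by apply: eq_bigr => j _; ring.
Qed.
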